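(* Let $M$ be a regular closed curve in $\mathbb{R}^2$. At an inflexion point of $M$ the set $\mathrm{SC}(M)$ passes through the origin; that is, if $p$ is an inflexion point of $M$, then the origin $\mathbf{0}$ belongs to $\mathrm{SC}(M)$, as a limit of differences $a-b$ of parallel pairs $a,b$ of $M$ approaching $p$ from different sides.
   Context: A closed regular curve $M$ is the image of a $C^\infty$ immersion $f:S^1\to\mathbb{R}^2$. A parallel pair of $M$ is a pair of points $a,b\in M$, $a\neq b$, such that the tangent lines to $M$ at $a$ and $b$ are parallel. The secant caustic is $\mathrm{SC}(M)=\mathrm{cl}\{a-b : a,b \text{ is a parallel pair of } M\}$, where $\mathrm{cl}$ is the closure in $\mathbb{R}^2$. A point $p$ of $M$ is an inflexion point if the signed curvature of $M$ changes sign at $p$. *)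

(* Defs.v *)
From mathcomp Require Import all_boot all_order all_algebra.
From mathcomp Require Import all_classical all_reals all_analysis.

Set Implicit Arguments.
Unset Strict Implicit.
Unset Printing Implicit Defensive.

Import Order.TTheory GRing.Theory Num.Theory.
Import numFieldNormedType.Exports.

Local Open Scope classical_set_scope.
Local Open Scope ring_scope.

Definition unit_circle (R : realType) : set (R * R) :=
  [set z | z.1 ^+ 2 + z.2 ^+ 2 = 1].

(* A map [f] on the unit circle is given by a function on the plane, of which
   only the values on [unit_circle] are ever used.  The angle
   [t |-> (cos t, sin t)] is a local diffeomorphism onto the circle, so that
   smoothness, derivatives and one-sided neighbourhoods on the circle are those
   of [angular f] on the line. *)
Definition angular (R : realType) (f : R * R -> R * R) (t : R) : R * R :=
  f (cos t, sin t).

Definition smooth (R : realType) (g : R -> R * R) : Prop :=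
  forall (n : nat) (t : R), derivable (derive1n n g) t 1.

Definition circle_immersion (R : realType) (f : R * R -> R * R) : Prop :=
  smooth (angular f) /\ forall t : R, derive1 (angular f) t != 0.

Definition curve (R : realType) (f : R * R -> R * R) : set (R * R) :=
  f @` @unit_circle R.

Definition det2 (R : realType) (u v : R * R) : R := u.1 * v.2 - u.2 * v.1.

(* The library norm on [R * R] is the sup norm. *)
Definition euclidean_norm (R : realType) (u : R * R) : R :=
  Num.sqrt (u.1 ^+ 2 + u.2 ^+ 2).

Definition signed_curvature (R : realType) (g : R -> R * R) (t : R) : R :=
  det2 (derive1 g t) (derive1n 2 g t) / euclidean_norm (derive1 g t) ^+ 3.

Definition changes_sign_at (R : realType) (k : R -> R) (t : R) : Prop :=
  ((\forall s \near t^'-, k s < 0) /\ (\forall s \near t^'+, 0 < k s)) \/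
  ((\forall s \near t^'-, 0 < k s) /\ (\forall s \near t^'+, k s < 0)).

Definition inflexion_at (R : realType) (f : R * R -> R * R) (t : R) : Prop :=
  changes_sign_at (signed_curvature (angular f)) t.

Definition inflexion_point (R : realType) (f : R * R -> R * R) (p : R * R) :
    Prop :=
  exists2 t : R, angular f t = p & inflexion_at f t.

(* Two distinct points of the curve, each with the branch through it selected by
   an angle; for an immersion the velocities do not vanish, so proportionality
   says that the tangent lines have the same direction (they may coincide). *)
Definition parallel_at (R : realType) (f : R * R -> R * R) (s t : R) : Prop :=
  angular f s != angular f t /\
  exists c : R, derive1 (angular f) t = c *: derive1 (angular f) s.

Definition parallel_pair (R : realType) (f : R * R -> R * R) (a b : R * R) :
    Prop :=
  [/\ curve f a, curve f b &
    exists s t : R, [/\ angular f s = a, angular f t = b & parallel_at f s t]].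

Definition secant_caustic (R : realType) (f : R * R -> R * R) : set (R * R) :=
  closure [set d | exists a b : R * R, parallel_pair f a b /\ d = a - b].

(* Main.v *)
Require Import Defs.
From mathcomp Require Import all_boot all_order all_algebra.
From mathcomp Require Import all_classical all_reals all_analysis.
From mathcomp Require Import ring lra.

Set Implicit Arguments.
Unset Strict Implicit.

Import Order.TTheory GRing.Theory Num.Theory.
Import numFieldNormedType.Exports.

Local Open Scope classical_set_scope.
Local Open Scope ring_scope.

(** Write [g] for the curve as a function of the angle, [t0] for the angle of
    the inflexion and [v := g' t0].  Near [t0] the velocity [g' t] makes an acute
    angle with [v], so its direction is recorded faithfully by the slope
    [phi t := det2 v (g' t) / dot2 v (g' t)], the tangent of the angle from [v]
    to [g' t].  The derivative of [phi] is [det2 (g' t) (g'' t)] times a positive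
    factor ([is_derive_slope]), hence it has the sign of the curvature.  At an
    inflexion this sign changes, so [phi] has a strict local extremum at [t0]:
    the tangent direction turns one way and then turns back.  By the
    intermediate value theorem a continuous function takes a common value on the
    two sides of a strict extremum, as close to it as desired
    ([equal_values_across_extremum]), and equal slopes mean proportional
    velocities ([eq_slope_proportional]).

    The two angles found in this way give different points of the curve, because
    [dot2 v (g t)] is strictly increasing where [dot2 v (g' t) > 0]: a short arc
    has no self-intersection.  Shrinking the neighbourhood gives sequences of
    parallel pairs that close in on the inflexion from its two sides, and the
    differences of these pairs tend to the origin. *)

(** * Equal values on the two sides of an extremum *)

Lemma within_is_derive_continuous (R : realType) (phi dphi : R -> R) (a b : R) :
  (forall x : R, x \in `[a, b] -> is_derive x 1 phi (dphi x)) ->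
  {within `[a, b], continuous phi}.
Proof.
move=> dphiP; apply: derivable_within_continuous => x xab.
by case: (dphiP x xab).
Qed.

Lemma lt_of_is_derive_pos (R : realType) (phi dphi : R -> R) (a b : R) :
  a < b -> (forall x : R, x \in `[a, b] -> is_derive x 1 phi (dphi x)) ->
  (forall x : R, a < x < b -> 0 < dphi x) -> phi a < phi b.
Proof.
move=> ab dphiP pos; have cont := within_is_derive_continuous dphiP.
have dphi_oo (x : R) : x \in `]a, b[ -> is_derive x 1 phi (dphi x).
  by move=> /subset_itv_oo_cc; exact: dphiP.
have [c + eqc] := MVT ab dphi_oo cont.
rewrite in_itv /= => /pos dc; rewrite -subr_gt0 eqc mulr_gt0 // subr_gt0.
exact: ab.
Qed.

Lemma lt_of_is_derive_neg (R : realType) (phi dphi : R -> R) (a b : R) :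
  a < b -> (forall x : R, x \in `[a, b] -> is_derive x 1 phi (dphi x)) ->
  (forall x : R, a < x < b -> dphi x < 0) -> phi b < phi a.
Proof.
move=> ab dphiP neg; rewrite -ltrN2.
apply: (@lt_of_is_derive_pos _ (fun x => - phi x) (fun x => - dphi x) _ _ ab).
  by move=> x xab; apply: is_deriveN; exact: dphiP.
by move=> x xab; rewrite oppr_gt0; exact: neg.
Qed.

(** Both [phi (t0 - d)] and [phi (t0 + d)] exceed [phi t0], so the smaller of
    them is also attained between [t0] and the other endpoint. *)
Lemma equal_values_across_minimum (R : realType) (phi dphi : R -> R) (t0 : R) :
  (\forall x \near t0, is_derive (x : R) 1 phi (dphi x)) ->
  (\forall x \near t0^'-, dphi x < 0) -> (\forall x \near t0^'+, 0 < dphi x) ->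
  forall e : R, 0 < e ->
  exists s t : R, [/\ t0 - e < s, s < t0, t0 < t, t < t0 + e & phi s = phi t].
Proof.
move=> dphiP decr incr e e0.
have decr' : \forall x \near t0, x < t0 -> dphi x < 0 := decr.
have incr' : \forall x \near t0, t0 < x -> 0 < dphi x := incr.
have [r /= r0 near_t0] : nbhs_ball t0 [set x : R | is_derive x 1 phi (dphi x) /\
    (x < t0 -> dphi x < 0) /\ (t0 < x -> 0 < dphi x)].
  by apply/nbhs_ballP; exact: filterI dphiP (filterI decr' incr').
pose d := Num.min r e / 2.
have [d0 dr de] : [/\ 0 < d, d < r & d < e].
  have m0 : 0 < Num.min r e by rewrite lt_min r0 e0.
  have [mr me] : Num.min r e <= r /\ Num.min r e <= e.
    by rewrite !ge_min !lexx orbT.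
  by split; rewrite /d; lra.
have near_d (x : R) : t0 - d <= x <= t0 + d ->
    [/\ is_derive x 1 phi (dphi x), x < t0 -> dphi x < 0 & t0 < x -> 0 < dphi x].
  move=> xd; have [|? [? ?]] := near_t0 x; last by [].
  rewrite /ball /= ltr_norml; lra.
have derive_left (x : R) : x \in `[t0 - d, t0] -> is_derive x 1 phi (dphi x).
  by rewrite in_itv /= => xd; have [] := near_d x; first lra.
have derive_right (x : R) : x \in `[t0, t0 + d] -> is_derive x 1 phi (dphi x).
  by rewrite in_itv /= => xd; have [] := near_d x; first lra.
have cont_left := within_is_derive_continuous derive_left.
have cont_right := within_is_derive_continuous derive_right.
have left_lt : t0 - d < t0 by lra.
have right_lt : t0 < t0 + d by lra.
have lt_left : phi t0 < phi (t0 - d).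
  apply: (lt_of_is_derive_neg left_lt derive_left) => x /andP[x1 x2].
  by have [|_ neg _] := near_d x; [lra|exact: neg].
have lt_right : phi t0 < phi (t0 + d).
  apply: (lt_of_is_derive_pos right_lt derive_right) => x /andP[x1 x2].
  by have [|_ _ pos] := near_d x; [lra|exact: pos].
have [le_lr|lt_rl] := leP (phi (t0 - d)) (phi (t0 + d)).
- have [|t] := @IVT _ phi t0 (t0 + d) (phi (t0 - d)) (ltW right_lt) cont_right.
    by rewrite ge_min le_max le_lr (ltW lt_left) orbT.
  rewrite in_itv /= => /andP[t1 t2] eqt.
  have t_neq : t != t0 by apply: contraTneq lt_left => t_eq; rewrite -eqt t_eq ltxx.
  have t0t : t0 < t by rewrite lt_def t_neq.
  by exists (t0 - d), t; split=> //; lra.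
- have [|s] := @IVT _ phi (t0 - d) t0 (phi (t0 + d)) (ltW left_lt) cont_left.
    by rewrite ge_min le_max (ltW lt_right) (ltW lt_rl) orbT.
  rewrite in_itv /= => /andP[s1 s2] eqs.
  have s_neq : t0 != s by apply: contraTneq lt_right => eq_s; rewrite -eqs -eq_s ltxx.
  have st0 : s < t0 by rewrite lt_def s_neq.
  by exists s, (t0 + d); split=> //; lra.
Qed.

Lemma equal_values_across_extremum (R : realType) (phi dphi : R -> R) (t0 : R) :
  (\forall x \near t0, is_derive (x : R) 1 phi (dphi x)) -> changes_sign_at dphi t0 ->
  forall e : R, 0 < e ->
  exists s t : R, [/\ t0 - e < s, s < t0, t0 < t, t < t0 + e & phi s = phi t].
Proof.
move=> dphiP [[neg pos]|[pos neg]] e e0.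
  exact: (equal_values_across_minimum dphiP).
have dN : \forall x \near t0, is_derive (x : R) 1 (fun y => - phi y) (- dphi x).
  by apply: filterS dphiP => x; exact: is_deriveN.
have negN : \forall x \near t0^'-, - dphi x < 0.
  by apply: filterS pos => x; rewrite oppr_lt0.
have posN : \forall x \near t0^'+, 0 < - dphi x.
  by apply: filterS neg => x; rewrite oppr_gt0.
have [s [t [es st0 t0t te /oppr_inj eq_st]]] :=
  equal_values_across_minimum dN negN posN e0.
by exists s, t.
Qed.

(** Transfers the sign change from the curvature to the derivative of the slope,
    which is a positive multiple of it. *)
Lemma changes_sign_at_mul_pos (R : realType) (c k : R -> R) (t0 : R) :
  (\forall x \near t0, 0 < c x) -> changes_sign_at k t0 ->
  changes_sign_at (fun x => c x * k x) t0.
Proof.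
move=> c_pos.
have c_left : \forall x \near t0^'-, 0 < c x by apply: cvg_within c_pos.
have c_right : \forall x \near t0^'+, 0 < c x by apply: cvg_within c_pos.
have pos F (FF : Filter F) : (\forall x \near F, 0 < c x) ->
    (\forall x \near F, 0 < k x) -> \forall x \near F, 0 < c x * k x.
  by apply: filterS2 => x; exact: mulr_gt0.
have neg F (FF : Filter F) : (\forall x \near F, 0 < c x) ->
    (\forall x \near F, k x < 0) -> \forall x \near F, c x * k x < 0.
  by apply: filterS2 => x cx kx; rewrite pmulr_rlt0.
by case=> -[k_left k_right]; [left|right]; split;
  by [exact: (pos _ _ _ k_left)|exact: (neg _ _ _ k_left)|
      exact: (pos _ _ _ k_right)|exact: (neg _ _ _ k_right)].
Qed.

(** * The slope of a plane vector relative to a fixed direction *)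

Definition dot2 (R : realType) (u v : R * R) : R := u.1 * v.1 + u.2 * v.2.

Lemma dot2_gt0 (R : realType) (v : R * R) : v != 0 -> 0 < dot2 v v.
Proof.
move=> v0; rewrite /dot2 -!expr2 lt_def addr_ge0 ?sqr_ge0 // andbT.
by rewrite paddr_eq0 ?sqr_ge0 // !sqrf_eq0 -[_ && _]/(v == 0).
Qed.

(** A vector is determined by its two components [dot2 v w] and [det2 v w] along
    [v] and across it; equal slopes make these components proportional. *)
Lemma eq_slope_proportional (R : realType) (v w z : R * R) :
  v != 0 -> dot2 v w != 0 -> dot2 v z != 0 ->
  det2 v w / dot2 v w = det2 v z / dot2 v z ->
  z = (dot2 v z / dot2 v w) *: w.
Proof.
move=> /dot2_gt0/lt0r_neq0 vv0 w0 z0 /eqP.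
rewrite eqr_div // => /eqP eq_wz.
have coord1 (y : R * R) : y.1 = (v.1 * dot2 v y - v.2 * det2 v y) / dot2 v v.
  by move: vv0; rewrite /dot2 /det2 => vv0; field.
have coord2 (y : R * R) : y.2 = (v.2 * dot2 v y + v.1 * det2 v y) / dot2 v v.
  by move: vv0; rewrite /dot2 /det2 => vv0; field.
have det_z : det2 v z = dot2 v z / dot2 v w * det2 v w.
  by apply: (mulIf w0); rewrite -eq_wz; field.
rewrite [LHS]surjective_pairing; congr (_, _); rewrite /= /GRing.scale /=.
- by rewrite (coord1 z) (coord1 w) det_z; field; rewrite vv0 w0.
- by rewrite (coord2 z) (coord2 w) det_z; field; rewrite vv0 w0.
Qed.

(** * Differentiation in the plane *)

Lemma is_derive_fst (R : realType) (g : R -> R * R) (t : R) (l : R * R) :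
  is_derive t 1 g l -> is_derive t 1 (fun x => (g x).1) l.1.
Proof.
case=> dg; rewrite /derive => gl.
have cvg1 : (fun h : R => h^-1 *: ((g (h *: 1 + t)).1 - (g t).1)) @ 0^' --> l.1.
  have cvg_g : (fun h : R => h^-1 *: (g (h *: 1 + t) - g t)) @ 0^' --> l.
    by rewrite -gl; exact: dg.
  exact: (@cvg_comp _ _ _ _ fst _ _ _ cvg_g cvg_fst).
split; first by apply/cvg_ex; exists l.1.
exact: cvg_lim.
Qed.

Lemma is_derive_snd (R : realType) (g : R -> R * R) (t : R) (l : R * R) :
  is_derive t 1 g l -> is_derive t 1 (fun x => (g x).2) l.2.
Proof.
case=> dg; rewrite /derive => gl.
have cvg2 : (fun h : R => h^-1 *: ((g (h *: 1 + t)).2 - (g t).2)) @ 0^' --> l.2.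
  have cvg_g : (fun h : R => h^-1 *: (g (h *: 1 + t) - g t)) @ 0^' --> l.
    by rewrite -gl; exact: dg.
  exact: (@cvg_comp _ _ _ _ snd _ _ _ cvg_g cvg_snd).
split; first by apply/cvg_ex; exists l.2.
exact: cvg_lim.
Qed.

Lemma is_derive_dot2 (R : realType) (v l : R * R) (g : R -> R * R) (t : R) :
  is_derive t 1 g l -> is_derive t 1 (fun x => dot2 v (g x)) (dot2 v l).
Proof.
move=> dg; have d1 := is_derive_fst dg; have d2 := is_derive_snd dg.
exact: (is_deriveD (is_deriveZ v.1 d1) (is_deriveZ v.2 d2)).
Qed.

Lemma is_derive_det2 (R : realType) (v l : R * R) (g : R -> R * R) (t : R) :
  is_derive t 1 g l -> is_derive t 1 (fun x => det2 v (g x)) (det2 v l).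
Proof.
move=> dg; have d1 := is_derive_fst dg; have d2 := is_derive_snd dg.
exact: (is_deriveB (is_deriveZ v.1 d2) (is_deriveZ v.2 d1)).
Qed.

(** The quotient rule leaves
    [det2 v l * dot2 v (g t) - det2 v (g t) * dot2 v l] in the numerator, which
    is [dot2 v v * det2 (g t) l] by a Lagrange-type identity.  With [g] a velocity
    and [l] an acceleration, [det2 (g t) l] is the numerator of the curvature. *)
Lemma is_derive_slope (R : realType) (v l : R * R) (g : R -> R * R) (t : R) :
  dot2 v (g t) != 0 -> is_derive t 1 g l ->
  is_derive t 1 (fun x => det2 v (g x) / dot2 v (g x))
    (dot2 v v * det2 (g t) l / dot2 v (g t) ^+ 2).
Proof.
move=> u0 dg.
have dV := @is_deriveV _ (fun x => dot2 v (g x)) t _ _ u0 (is_derive_dot2 v dg).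
have dM := is_deriveM (is_derive_det2 v dg) dV.
apply: (@is_derive_eq _ _ _ _ _ _ _ _ dM).
rewrite /GRing.scale /=; move: u0; rewrite /det2 /dot2 => u0; field.
exact: u0.
Qed.

(** * Parallel pairs around an inflexion *)

Lemma smooth_is_derive (R : realType) (g : R -> R * R) (n : nat) (t : R) :
  smooth g -> is_derive t 1 (derive1n n g) (derive1n n.+1 g t).
Proof.
by move=> smooth_g; rewrite derive1nS derive1E; apply: derivableP.
Qed.

Lemma smooth_continuous (R : realType) (g : R -> R * R) (n : nat) :
  smooth g -> continuous (derive1n n g).
Proof.
move=> smooth_g t.
exact/differentiable_continuous/derivable1_diffP/smooth_g.
Qed.

(** The core of the proof: the slope has an extremum at the inflexion, equal
    slopes give parallel tangents, and monotonicity of [dot2 v (angular f x)]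
    separates the two points. *)
Lemma parallel_across_inflexion (R : realType) (f : R * R -> R * R) (t0 : R) :
  circle_immersion f -> inflexion_at f t0 -> forall e : R, 0 < e ->
  exists s t : R, [/\ t0 - e < s, s < t0, t0 < t, t < t0 + e & parallel_at f s t].
Proof.
move=> [smooth_g immersive] inflexion e e0.
set g := angular f in smooth_g immersive *.
set v := derive1 g t0.
have dg (x : R) : is_derive x 1 g (derive1 g x) := smooth_is_derive 0 x smooth_g.
have ddg (x : R) : is_derive x 1 (derive1 g) (derive1n 2 g x) :=
  smooth_is_derive 1 x smooth_g.
pose u (x : R) := dot2 v (derive1 g x).
have u_pos : \forall x \near t0, 0 < u x.
  have u_cont : {for t0, continuous u}.
    apply/differentiable_continuous/derivable1_diffP.
    by case: (is_derive_dot2 v (ddg t0)).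
  by apply: (cvgr_gt _ u_cont); exact: (dot2_gt0 (immersive t0)).
(* The ratio of the derivative of the slope to the signed curvature; the cube of
   the speed cancels the denominator of the curvature. *)
pose c (x : R) := dot2 v v * euclidean_norm (derive1 g x) ^+ 3 / u x ^+ 2.
have norm_pos (x : R) : 0 < euclidean_norm (derive1 g x).
  by rewrite sqrtr_gt0 !expr2; apply: dot2_gt0.
have c_pos : \forall x \near t0, 0 < c x.
  apply: filterS u_pos => x ux.
  apply: divr_gt0; last exact: exprn_gt0.
  apply: mulr_gt0; first exact: (dot2_gt0 (immersive t0)).
  exact: exprn_gt0.
pose phi (x : R) := det2 v (derive1 g x) / u x.
have dphi : \forall x \near t0,
    is_derive (x : R) 1 phi (c x * signed_curvature g x).
  apply: filterS u_pos => x ux.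
  apply: (@is_derive_eq _ _ _ _ _ _ _ _ (is_derive_slope (lt0r_neq0 ux) (ddg x))).
  rewrite /c /signed_curvature -/(u x); field.
  by rewrite !lt0r_neq0.
have [r r0 u_ball] : exists2 r : R, 0 < r & forall x : R, `|t0 - x| < r -> 0 < u x.
  by have /nbhs_ballP[r r0 u_ball] := u_pos; exists r.
have m0 : 0 < Num.min r e by rewrite lt_min r0 e0.
have [mr me] : Num.min r e <= r /\ Num.min r e <= e.
  by rewrite !ge_min !lexx orbT.
(* The pair is sought where [u > 0] as well, because both the slope and the
   injectivity of the arc depend on it. *)
have [s [t [es st0 t0t te phi_st]]] :=
  equal_values_across_extremum dphi (changes_sign_at_mul_pos c_pos inflexion) m0.
have u_st (x : R) : s <= x <= t -> 0 < u x.
  move=> xst; apply: u_ball; rewrite ltr_norml; clearbody u.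
  clear -es te mr me xst; lra.
have st : s < t := lt_trans st0 t0t.
have es' : t0 - e < s by clear -es me; lra.
have te' : t < t0 + e by clear -te me; lra.
exists s, t; split; [exact: es'|exact: st0|exact: t0t|exact: te'|split].
- have dv (x : R) : x \in `[s, t] -> is_derive x 1 (fun y => dot2 v (g y)) (u x).
    by move=> _; apply: is_derive_dot2.
  have lt_st : dot2 v (g s) < dot2 v (g t).
    apply: (lt_of_is_derive_pos st dv) => x /andP[x1 x2].
    by apply: u_st; rewrite !ltW.
  by apply: contraTneq lt_st => g_st; rewrite /g g_st ltxx.
- have us : 0 < u s by apply: u_st; rewrite lexx ltW.
  have ut : 0 < u t by apply: u_st; rewrite lexx ltW.
  exists (u t / u s).
  exact: (eq_slope_proportional (immersive t0) (lt0r_neq0 us) (lt0r_neq0 ut) phi_st).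
Qed.

Lemma curve_angular (R : realType) (f : R * R -> R * R) (t : R) :
  curve f (angular f t).
Proof. by exists (cos t, sin t) => //; exact: cos2Dsin2. Qed.

Lemma parallel_at_pair (R : realType) (f : R * R -> R * R) (s t : R) :
  parallel_at f s t -> parallel_pair f (angular f s) (angular f t).
Proof.
move=> st; split; [exact: curve_angular|exact: curve_angular|].
by exists s, t.
Qed.

Lemma parallel_pairs_tend_to_inflexion (R : realType) (f : R * R -> R * R)
    (t0 : R) : circle_immersion f -> inflexion_at f t0 ->
  exists s t : nat -> R,
    [/\ forall n, s n < t0 /\ t0 < t n /\ parallel_at f (s n) (t n),
      s @ \oo --> t0 & t @ \oo --> t0].
Proof.
move=> immersion inflexion.
have /choice[st stP] (n : nat) : exists st : R * R,
    [/\ t0 - harmonic n < st.1, st.1 < t0, t0 < st.2, st.2 < t0 + harmonic n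
      & parallel_at f st.1 st.2].
  have [s [t ?]] := parallel_across_inflexion immersion inflexion (harmonic_gt0 n).
  by exists (s, t).
exists (fun n => (st n).1), (fun n => (st n).2); split.
- by move=> n; have [_ ? ? _ ?] := stP n.
- apply: (@squeeze_cvgr _ _ _ _ (fun n => t0 - harmonic n) (fun=> t0)).
  + by near=> n; have [? ? _ _ _] := stP n; rewrite !ltW.
  + by rewrite -[X in _ --> X]subr0; apply: cvgB; [exact: cvg_cst|exact: cvg_harmonic].
  + exact: cvg_cst.
- apply: (@squeeze_cvgr _ _ _ _ (fun=> t0) (fun n => t0 + harmonic n)).
  + by near=> n; have [_ _ ? ? _] := stP n; rewrite !ltW.
  + exact: cvg_cst.
  + by rewrite -[X in _ --> X]addr0; apply: cvgD; [exact: cvg_cst|exact: cvg_harmonic].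
Unshelve. all: by end_near.
Qed.

Theorem proposition2p21 (R : realType) (f : R * R -> R * R)
    (f_immersion : circle_immersion f) (p : R * R)
    (p_inflexion : inflexion_point f p) :
  secant_caustic f 0 /\
  (forall t0 : R, angular f t0 = p -> inflexion_at f t0 ->
   exists s t : nat -> R,
     (forall n, s n < t0 /\ t0 < t n /\ parallel_at f (s n) (t n) /\
                parallel_pair f (angular f (s n)) (angular f (t n))) /\
     s @ \oo --> t0 /\
     t @ \oo --> t0 /\
     (fun n => angular f (s n)) @ \oo --> p /\
     (fun n => angular f (t n)) @ \oo --> p /\
     (fun n => angular f (s n) - angular f (t n)) @ \oo --> (0 : R * R)).
Proof.
have g_cont : continuous (angular f).
  by case: f_immersion => smooth_g _; exact: (smooth_continuous (n := 0) smooth_g).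
have approach (t0 : R) : angular f t0 = p -> inflexion_at f t0 ->
    exists s t : nat -> R,
      [/\ forall n, s n < t0 /\ t0 < t n /\ parallel_at f (s n) (t n),
        s @ \oo --> t0, t @ \oo --> t0,
        (fun n => angular f (s n)) @ \oo --> p &
        (fun n => angular f (t n)) @ \oo --> p].
  move=> <- inflexion.
  have [s [t [st s_cvg t_cvg]]] :=
    parallel_pairs_tend_to_inflexion f_immersion inflexion.
  exists s, t; split; [exact: st|exact: s_cvg|exact: t_cvg| |].
  - exact: (cvg_comp _ _ s_cvg (g_cont t0)).
  - exact: (cvg_comp _ _ t_cvg (g_cont t0)).
have diff_cvg (a b : nat -> R * R) : a @ \oo --> p -> b @ \oo --> p ->
    (fun n => a n - b n) @ \oo --> (0 : R * R).
  by move=> a_cvg b_cvg; rewrite -(subrr p); exact: cvgB.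
split=> [|t0 gt0 inflexion].
- have [t0 gt0 inflexion] := p_inflexion.
  have [s [t [st _ _ gs_cvg gt_cvg]]] := approach t0 gt0 inflexion.
  move=> B /(diff_cvg _ _ gs_cvg gt_cvg)[N _ BN].
  exists (angular f (s N) - angular f (t N)); split; last by apply: BN => /=.
  exists (angular f (s N)), (angular f (t N)); split=> //.
  by apply: parallel_at_pair; have [_ []] := st N.
- have [s [t [st s_cvg t_cvg gs_cvg gt_cvg]]] := approach t0 gt0 inflexion.
  exists s, t; split.
    move=> n; have [s_lt [t_gt par]] := st n.
    exact: (conj s_lt (conj t_gt (conj par (parallel_at_pair par)))).
  do 4!split=> //; exact: diff_cvg.
Qed.
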